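(* Let $G=(X,W)$ be a weighted graph, let $\Gamma\subset X$ be nonempty, let $p>0$ and let $f:X\to\mathbb{R}$ with $f>0$. If $G$ is connected, then the $p$-eikonal equation $$\mathcal{A}_{G,p}u=f\ \text{ in }X\setminus\Gamma,\qquad u=0\ \text{ on }\Gamma,$$ has a unique solution $u:X\to\mathbb{R}$, and for all $x_i\in X$ $$K^{-\frac1p}\left(\min_X f^{\frac1p}\right)d_{G^{1/p}}(x_i,\Gamma)\le u(x_i)\le\left(\max_X f^{\frac1p}\right)d_{G^{1/p}}(x_i,\Gamma).$$
   Context: A weighted graph $G=(X,W)$ has vertices $X=\{x_1,\dots,x_n\}\subset\mathbb{R}^d$ and nonnegative edge weights $W=(w_{ij})_{i,j=1}^n$, not assumed symmetric; $w_{ij}=0$ means there is no edge from $i$ to $j$. The $p$-eikonal operator is $$\mathcal{A}_{G,p}u(x_i)=\sum_{j=1}^n w_{ji}\,(u(x_i)-u(x_j))_+^p,\qquad a_+=\max\{a,0\}.$$ $K=\max_{1\le i\le n}\sum_{j=1}^n\mathbf{1}_{w_{ji}>0}$ is the maximum unweighted incoming degree. Graph distance: $d_G(x_i,x_j)$ is the minimum, over all directed paths $i=\tau_0,\tau_1,\dots,\tau_m=j$ (any number of steps $m\ge0$), of $\sum_{l=0}^{m-1}w_{\tau_l,\tau_{l+1}}^{-1}$, with the convention $0^{-1}=\infty$; in particular $d_G(x_i,x_i)=0$. $G$ is connected if $d_G(x_i,x_j)<\infty$ for all $x_i,x_j\in X$. The distance to $\Gamma$ is $d_G(x_i,\Gamma)=\min_{x_j\in\Gamma}d_G(x_j,x_i)$,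 i.e. the length of a shortest directed path from $\Gamma$ to $x_i$. For $q>0$, $G^{q}=(X,W^{q})$ denotes the graph with weights $w_{ij}^{q}$ (entrywise power); $d_{G^{1/p}}$ is the graph distance of $G^{1/p}$. *)

(* Defs.v *)
From HB Require Import structures.
From mathcomp Require Import all_boot all_order all_algebra.
From mathcomp Require Import all_classical all_reals all_analysis.
Set Implicit Arguments.
Unset Strict Implicit.
Unset Printing Implicit Defensive.
Import Order.TTheory GRing.Theory Num.Theory.
Local Open Scope classical_set_scope.
Local Open Scope ring_scope.

(* The vertices are n distinct points of R^d; a function on the vertex set is
   represented by a function on the indices 'I_n, and a set of vertices by the
   set of their indices. *)
Record weighted_graph (R : realType) (d n : nat) := WeightedGraph {
  vertex : 'I_n -> 'rV[R]_d;
  vertex_inj : injective vertex;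
  weight : 'M[R]_n;
  weight_ge0 : forall i j, 0 <= weight i j
}.

Section Defs.
Context {R : realType} {d n : nat}.
Implicit Types (G : weighted_graph R d n) (u f : 'I_n -> R) (Gamma : {set 'I_n}).

Lemma weight_pow_ge0 G (q : R) i j :
  0 <= (map_mx (fun w => w `^ q) (weight G)) i j.
Proof. by rewrite mxE powR_ge0. Qed.

Definition graph_pow G (q : R) : weighted_graph R d n :=
  WeightedGraph (@vertex_inj _ _ _ G) (weight_pow_ge0 G q).

Definition eikonal_op (p : R) G u (i : 'I_n) : R :=
  \sum_(j < n) weight G j i * (Num.max (u i - u j) 0) `^ p.

Definition max_in_degree G : nat :=
  \max_(i < n) \sum_(j < n) (0 < weight G j i)%R.

(* Length of the path i :: s; inversion is that of \bar R, for which
   0^-1 = +oo, so a path using a missing edge has length +oo. *)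
Fixpoint path_length G (i : 'I_n) (s : seq 'I_n) : \bar R :=
  if s is j :: s' then (((weight G i j)%:E)^-1 + path_length G j s')%E else 0%E.

(* The infimum is a minimum, see graph_dist_attained. *)
Definition graph_dist G (i j : 'I_n) : \bar R :=
  ereal_inf [set path_length G i s | s in [set s | last i s = j]].

Definition connected_graph G : Prop :=
  forall i j : 'I_n, (graph_dist G i j < +oo)%E.

Definition dist_to G (i : 'I_n) Gamma : \bar R :=
  \big[Order.min/+oo%E]_(j in Gamma) graph_dist G j i.

Definition eikonal_solution (p : R) G Gamma f u : Prop :=
  (forall i, i \notin Gamma -> eikonal_op p G u i = f i) /\
  (forall i, i \in Gamma -> u i = 0).

Lemma einv_weight_ge0 G i j : (0 <= ((weight G i j)%:E)^-1)%E.
Proof. by rewrite inve_ge0 lee_fin weight_ge0. Qed.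

Lemma path_length_ge0 G i s : (0 <= path_length G i s)%E.
Proof.
by elim: s i => //= j s IH i; apply: adde_ge0; rewrite ?einv_weight_ge0.
Qed.

Lemma path_length_cat G i s t :
  path_length G i (s ++ t) = (path_length G i s + path_length G (last i s) t)%E.
Proof. by elim: s i => [|j s IH] i /=; rewrite ?add0e// IH addeA. Qed.

(* Every path dominates a simple path with the same endpoints. *)
Lemma path_length_uniq G i s : exists t,
  [/\ uniq t, last i t = last i s & (path_length G i t <= path_length G i s)%E].
Proof.
have [m] := ubnP (size s); elim: m s => // m IH s sm.
have [us|nus] := boolP (uniq s); first by exists s.
suff [t [ts lt lets]] : exists t, [/\ (size t < size s)%N, last i t = last i s
    & (path_length G i t <= path_length G i s)%E].
  have [|t' [? l' le']] := IH t; first by rewrite (leq_trans ts).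
  by exists t'; split=> //; [rewrite l'|exact: le_trans le' _].
elim: s i nus {sm IH} => //= j s IHs i; rewrite negb_and negbK.
have [js _|_ /= nus] := boolP (j \in s); last first.
  have [t [ts lt le]] := IHs j nus; exists (j :: t); split => //=.
  by rewrite leeD2l.
case/splitPr: js => a b; exists (j :: b); split.
- by rewrite /= size_cat /= addnS ltnS ltnS leq_addl.
- by rewrite /= last_cat.
- rewrite /= leeD2l// path_length_cat /= addeA leeDr//.
  by rewrite adde_ge0 ?path_length_ge0 ?einv_weight_ge0.
Qed.

Lemma graph_dist_attained G i j :
  exists2 s, last i s = j & path_length G i s = graph_dist G i j.
Proof.
pose T := {m : 'I_n.+1 & m.-tuple 'I_n}.
pose F (x : T) : \bar R := path_length G i (tagged x).
pose Q (x : T) := last i (tagged x) == j.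
have toT s : last i s = j ->
    exists2 x : T, Q x & (F x <= path_length G i s)%E.
  move=> sj; have [t [ut lt le]] := path_length_uniq G i s.
  have st : (size t < n.+1)%N.
    by rewrite ltnS -[leqRHS]card_ord -(card_uniqP ut) max_card.
  exists (existT (fun m : 'I_n.+1 => m.-tuple 'I_n) (Ordinal st) (in_tuple t)) => //.
  by rewrite /Q /= lt sj.
have [x1 Qx1 _] := toT [:: j] erefl.
case: (arg_minP F Qx1) => x Qx xmin.
exists (tagged x); first exact/eqP.
apply/eqP; rewrite eq_le; apply/andP; split.
  apply: le_ereal_inf_tmp => _ [s /= sj <-].
  by have [y Qy Fy] := toT _ sj; exact: le_trans (xmin _ Qy) Fy.
by apply: ereal_inf_lbound; exists (tagged x) => //=; exact/eqP.
Qed.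

End Defs.

(* Main.v *)
(* Subsolutions lie below supersolutions (eikonal_comparison), which gives
   uniqueness.  If M and m are the maximum and the minimum of f^(1/p), then
   M d(., Gamma) is a supersolution, because the last edge j -> i of a shortest
   path satisfies d(i) - d(j) = w_ji^(-1/p) and thus contributes M^p to the
   operator; K^(-1/p) m d(., Gamma) is a subsolution, because each of the at
   most K incoming edges satisfies d(i) - d(j) <= w_ji^(-1/p) and contributes
   at most m^p / K.  Both vanish on Gamma, so comparison yields the bounds. *)
Require Import Defs.
From mathcomp Require Import all_boot all_order all_algebra.
From mathcomp Require Import all_classical all_reals all_analysis.
From mathcomp Require Import lra.
Set Implicit Arguments.
Unset Strict Implicit.
Unset Printing Implicit Defensive.
Import Order.TTheory GRing.Theory Num.Theory.
Import numFieldNormedType.Exports.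
Local Open Scope ring_scope.

(** * Powers of the positive part *)

Section PositivePartPower.
Context {R : realType} (p : R) (p_gt0 : 0 < p).
Implicit Types (x y : R).

Lemma max0_ge0 x : 0 <= Num.max x 0.
Proof. by rewrite le_max lexx orbT. Qed.

Lemma pospow_le0 x : x <= 0 -> (Num.max x 0) `^ p = 0.
Proof. by move=> x0; rewrite max_r// powR0// gt_eqF. Qed.

Lemma ler_pospow x y : x <= y -> (Num.max x 0) `^ p <= (Num.max y 0) `^ p.
Proof.
move=> xy; apply: ge0_ler_powR; rewrite ?nnegrE ?max0_ge0 ?(ltW p_gt0)//.
by rewrite ge_max max0_ge0 le_max xy.
Qed.

Lemma ltr_pospow x y : 0 < y -> x < y ->
  (Num.max x 0) `^ p < (Num.max y 0) `^ p.
Proof.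
move=> y0 xy; apply: gt0_ltr_powR; rewrite ?nnegrE ?max0_ge0//.
by rewrite gt_max !lt_max xy y0.
Qed.

Lemma powR_invK x : 0 <= x -> (x `^ (1 / p)) `^ p = x.
Proof. by move=> x0; rewrite -powRrM div1r mulVf ?gt_eqF// powRr1. Qed.

(** This is why distances are taken in $G^{1/p}$: there an edge of weight w has length $w^{-1/p}$,
    so an increment of x times that length contributes $x^p$ to the operator, whatever w is. *)
Lemma mulr_pospow_inv w x : 0 < w -> 0 <= x ->
  w * (Num.max (x * (w `^ (1 / p))^-1) 0) `^ p = x `^ p.
Proof.
move=> w0 x0; rewrite max_l ?mulr_ge0 ?invr_ge0 ?powR_ge0//.
rewrite powRM// ?invr_ge0 ?powR_ge0// -powR_inv1 ?powR_ge0//.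
rewrite powRAC powR_invK ?ltW// powR_inv1 ?ltW//.
by rewrite mulrCA divff ?gt_eqF// mulr1.
Qed.

Lemma continuous_pospow : continuous (fun x => (Num.max x 0) `^ p).
Proof.
move=> x; have [x0|x0] := leP x 0.
  apply/cvgrPdist_lt => e e0; rewrite pospow_le0//.
  (* The radius is chosen so that $t < x + e^{1/p}$ and $x \le 0$ give $t_+^p < e$. No derivative at
     0 is involved, so small p is covered. *)
  have d0 : 0 < e `^ (1 / p) by rewrite powR_gt0.
  have : \forall t \near x, t < x + e `^ (1 / p).
    by apply: lt_nbhsl; rewrite ltrDl.
  apply: filterS => t tx.
  rewrite sub0r normrN ger0_norm ?powR_ge0// -[ltRHS]powR_invK ?(ltW e0)//.
  apply: gt0_ltr_powR; rewrite ?nnegrE ?max0_ge0 ?powR_ge0//.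
  by rewrite gt_max d0 andbT (lt_le_trans tx)// gerDr.
have : ((fun t : R => t `^ p) @ x --> x `^ p)%classic.
  apply: (@differentiable_continuous _ _ _ x (@powR R ^~ p)).
  by apply/derivable1_diffP/derivable_powR; rewrite in_itv/= x0.
rewrite /continuous_at max_l ?ltW//; apply: cvg_trans; apply: near_eq_cvg.
near=> t; rewrite max_l// ltW//.
by near: t; exact: lt_nbhsr.
Unshelve. all: by end_near. Qed.

End PositivePartPower.

(** * Comparison principle and solvability *)

Section Eikonal.
Context {R : realType} {d n : nat} (p : R) (p_gt0 : 0 < p).
Implicit Types (G : weighted_graph R d n) (u v f : 'I_n -> R).
Implicit Types (Gamma : {set 'I_n}) (i j : 'I_n).

Lemma le_eikonal_op G u v i : (forall j, u i - u j <= v i - v j) ->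
  eikonal_op p G u i <= eikonal_op p G v i.
Proof.
move=> uv; apply: ler_sum => j _.
by rewrite ler_wpM2l ?weight_ge0// ler_pospow.
Qed.

(** The positive part is flat on nonpositive increments, so strictness at j requires the larger
    increment to be positive. *)
Lemma lt_eikonal_op G u v i j : 0 < weight G j i -> 0 < v i - v j ->
    u i - u j < v i - v j -> (forall k, u i - u k <= v i - v k) ->
  eikonal_op p G u i < eikonal_op p G v i.
Proof.
move=> wji vij uvj uv; rewrite /eikonal_op (bigD1 j)//= [ltRHS](bigD1 j)//=.
apply: ltr_leD; first by rewrite ltr_pM2l// ltr_pospow.
by apply: ler_sum => k _; rewrite ler_wpM2l ?weight_ge0// ler_pospow.
Qed.

Lemma eikonal_op_gt0 G u i : 0 < eikonal_op p G u i ->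
  exists2 j, 0 < weight G j i & u j < u i.
Proof.
rewrite lt0r => /andP[+ _]; rewrite psumr_eq0; last first.
  by move=> j _; rewrite mulr_ge0 ?weight_ge0 ?powR_ge0.
case/allPn => j _; rewrite mulf_eq0 negb_or => /andP[w0 pu].
exists j; first by rewrite lt0r w0 weight_ge0.
by rewrite ltNge; apply: contra pu => uij; rewrite pospow_le0// subr_le0.
Qed.

(* Among the maximizers of u - v take one minimizing u.  There the two
   operators agree, hence so do all the terms; since f > 0 some neighbor j has
   v j < v i, and j is then a maximizer with a smaller value of u. *)
Lemma eikonal_comparison G Gamma f u v :
    (forall i, i \notin Gamma -> 0 < f i) ->
    (forall i, i \notin Gamma -> eikonal_op p G u i <= f i) ->
    (forall i, i \notin Gamma -> f i <= eikonal_op p G v i) ->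
    (forall i, i \in Gamma -> u i <= v i) ->
  forall i, u i <= v i.
Proof.
move=> f0 subu supv uv i0; rewrite leNgt; apply/negP => lt0.
case: (@arg_maxP _ R 'I_n i0 predT (fun i => u i - v i)) => // m _ maxm.
have m0 : 0 < u m - v m by rewrite (lt_le_trans _ (maxm i0 _))// subr_gt0.
case: (@arg_minP _ R 'I_n m (fun i => u i - v i == u m - v m) u) => //.
move=> k /eqP km mink.
have kG : k \notin Gamma.
  by apply/negP => /uv; rewrite -subr_le0 km leNgt m0.
have maxk j : v k - v j <= u k - u j.
  by have := maxm j erefl; rewrite -km /=; lra.
have [j wj vj] : exists2 j, 0 < weight G j k & v j < v k.
  by apply: eikonal_op_gt0; rewrite (lt_le_trans (f0 _ kG)) ?supv.
have := maxk j; rewrite le_eqVlt => /orP[/eqP e|lt].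
  have : u k <= u j by apply: mink; rewrite -km; apply/eqP; lra.
  by lra.
have : eikonal_op p G v k < eikonal_op p G u k.
  by apply: (lt_eikonal_op wj) => //; lra.
by rewrite ltNge (le_trans (subu _ kG))// supv.
Qed.

(** Only the value at the center i moves, the values of u in the differences being frozen; Perron's
    method perturbs the supremum at one vertex. *)
Lemma continuous_eikonal_term G u i :
  continuous (fun t : R =>
    \sum_(j < n) weight G j i * (Num.max (t - u j) 0) `^ p).
Proof.
move=> t; apply: cvg_big => [|j _]; first exact: add_continuous.
apply: cvgMl_tmp.
apply: (@continuous_comp _ _ _ (fun t : R => t - u j)
  (fun x => (Num.max x 0) `^ p)); last exact: continuous_pospow.
by apply: cvgB; [exact: cvg_id|exact: cvg_cst].
Qed.

Definition eikonal_subsolution G Gamma f u : Prop :=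
  (forall i, i \notin Gamma -> eikonal_op p G u i <= f i) /\
  (forall i, i \in Gamma -> u i <= 0).

(* Perron's method: the solution is the pointwise supremum of the
   subsolutions, which the supersolution v bounds from above. *)
Lemma eikonal_exists G Gamma f v :
    (forall i, i \notin Gamma -> 0 < f i) ->
    (forall i, i \notin Gamma -> f i <= eikonal_op p G v i) ->
    (forall i, i \in Gamma -> 0 <= v i) ->
  exists u, eikonal_solution p G Gamma f u.
Proof.
move=> f0 supv v0.
pose S i : set R :=
  [set x | exists2 u, eikonal_subsolution G Gamma f u & u i = x]%classic.
(* The zero function is a subsolution because f > 0. *)
have S0 i : S i 0.
  exists (fun=> 0) => //; split=> // j /f0 /ltW; apply: le_trans.
  by rewrite /eikonal_op big1// => k _; rewrite pospow_le0 ?mulr0// subrr.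
have Sv i : ubound (S i) (v i).
  move=> _ [u [subu u0] <-].
  by apply: (eikonal_comparison f0 subu supv) => j jG;
    rewrite (le_trans (u0 _ jG))// v0.
have supS i : has_sup (S i) by split; [exists 0|exists (v i)].
pose U i := sup (S i).
have leU u : eikonal_subsolution G Gamma f u -> forall i, u i <= U i.
  by move=> su i; apply: ub_le_sup; [exists (v i)|exists u].
pose g i t := \sum_(j < n) weight G j i * (Num.max (t - U j) 0) `^ p.
have cg i : {for U i, continuous (g i)} by exact: continuous_eikonal_term.
have subU i : i \notin Gamma -> eikonal_op p G U i <= f i.
  (* If the operator exceeded f at i, so would [g i] at [u i] for some subsolution u with [u i]
     close to [U i]. Since u lies below U, the operator of u at i is at least [g i (u i)], a
     contradiction. *)
  move=> iG; rewrite leNgt; apply/negP => fU.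
  have /nbhs_ballP[e /= e0 ge] : nbhs (U i) (fun t => f i < g i t).
    exact: (cvgr_gt _ (cg i) _ fU).
  have [_ [u su <-] ue] := sup_adherent e0 (supS i).
  have : f i < g i (u i).
    apply: ge; rewrite /ball/= ger0_norm ?subr_ge0 ?leU//.
    by rewrite ltrBlDr addrC -ltrBlDr.
  rewrite ltNge => /negP; apply; apply: le_trans (su.1 _ iG).
  apply: ler_sum => j _; rewrite ler_wpM2l ?weight_ge0// ler_pospow//.
  by rewrite lerB// leU.
have U0 i : i \in Gamma -> U i = 0.
  move=> iG; apply/eqP; rewrite eq_le; apply/andP; split.
    by apply: ge_sup; [exists 0|move=> _ [u [_ u0] <-]; exact: u0].
  by apply: ub_le_sup; [exists (v i)|].
exists U; split=> // i iG; apply/eqP; rewrite eq_le subU//= leNgt.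
apply/negP => Uf.
have /nbhs_ballP[e /= e0 ge] : nbhs (U i) (fun t => g i t < f i).
  exact: (cvgr_lt _ (cg i) _ Uf).
have e20 : 0 < e / 2 by rewrite divr_gt0.
(* If the equation were strict at i, U could be raised there by e/2, which stays inside the ball of
   radius e, and the result would be a subsolution exceeding U. *)
pose u j := if j == i then U i + e / 2 else U j.
have Uu j : U j <= u j by rewrite /u; case: eqP => // ->; rewrite lerDl ltW.
suff /leU/(_ i) : eikonal_subsolution G Gamma f u.
  by rewrite /u eqxx leNgt ltrDl e20.
split=> j jG; last first.
  by rewrite /u; case: eqP => [ji|_]; [rewrite -ji jG in iG|rewrite U0].
(* At other vertices, raising the value at i can only decrease the differences. *)
have [ji|ji] := eqVneq j i; last first.
  apply: le_trans (subU _ jG); apply: le_eikonal_op => k.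
  by rewrite lerB// [in leLHS]/u (negbTE ji).
rewrite {j}ji in jG *.
(* At i, [U j <= u j] for every j, also for j = i (a loop), so [g i (U i + e / 2)] bounds the
   operator of u. *)
have /ltW : g i (U i + e / 2) < f i.
  apply: ge; rewrite /ball/= opprD addrA subrr sub0r normrN ger0_norm ?ltW//.
  by rewrite ltr_pdivrMr// ltr_pMr// ltr1n.
apply: le_trans; apply: ler_sum => j _; rewrite ler_wpM2l ?weight_ge0//.
by rewrite ler_pospow// /u eqxx lerB.
Qed.

End Eikonal.

(** * Finiteness of distances and one-edge inequalities *)

Section Distance.
Context {R : realType} {d n : nat}.
Implicit Types (G : weighted_graph R d n) (Gamma : {set 'I_n}) (i j k : 'I_n).
Local Open Scope ereal_scope.

Lemma path_length_lty G i s :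
  (path_length G i s < +oo) = path (fun j k => 0 < weight G j k)%R i s.
Proof.
elim: s i => [|j s IH] i /=; first by rewrite ltry.
rewrite -IH lt0r weight_ge0 andbT inver.
case: eqP => _ /=; last first.
  by case: (path_length G j s) => [r||] //=; rewrite -EFinD !ltry.
rewrite addye ?ltxx// gt_eqF//.
exact: lt_le_trans (path_length_ge0 G j s).
Qed.

Lemma graph_dist_le G i s : graph_dist G i (last i s) <= path_length G i s.
Proof. by apply: ereal_inf_lbound; exists s. Qed.

(** A path has finite length exactly when its edges have positive weight, and positive weights have
    positive powers. *)
Lemma connected_graph_pow G (q : R) :
  connected_graph G -> connected_graph (graph_pow G q).
Proof.
move=> cG i j; have [s sj sd] := graph_dist_attained G i j.
move: (cG i j); rewrite -sd path_length_lty -sj => Gs.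
apply: le_lt_trans (graph_dist_le _ _ _) _; rewrite path_length_lty.
by apply: sub_path Gs => a b ab; rewrite mxE powR_gt0.
Qed.

Lemma dist_to_le G i k Gamma : k \in Gamma ->
  dist_to G i Gamma <= graph_dist G k i.
Proof.
exact: (@bigmin_le_cond _ (\bar R) 'I_n +oo k (fun k => k \in Gamma)
  (fun k => graph_dist G k i)).
Qed.

Lemma dist_to_attained G i Gamma : Gamma != finset.set0 ->
  exists2 k, k \in Gamma & dist_to G i Gamma = graph_dist G k i.
Proof.
case/finset.set0Pn => k kG.
have [j jG e] := @eq_bigmin _ (\bar R) 'I_n +oo k (fun k => k \in Gamma)
  (fun k => graph_dist G k i) kG (fun _ _ => leey _).
by exists j.
Qed.

Lemma dist_to_ge0 G i Gamma : 0 <= dist_to G i Gamma.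
Proof.
apply: le_bigmin => [|j _]; first exact: le0y.
by have [s _ <-] := graph_dist_attained G j i; exact: path_length_ge0.
Qed.

Lemma dist_to_fin_num G i Gamma : connected_graph G -> Gamma != finset.set0 ->
  dist_to G i Gamma \is a fin_num.
Proof.
move=> cG /(dist_to_attained G i)[k _ e].
by rewrite ge0_fin_numE ?dist_to_ge0// e; exact: cG.
Qed.

Lemma dist_to_in G i Gamma : i \in Gamma -> dist_to G i Gamma = 0.
Proof.
move=> iG; apply/eqP; rewrite eq_le dist_to_ge0 andbT.
apply: le_trans (dist_to_le _ _ iG) _; exact: (graph_dist_le G i [::]).
Qed.

(** Append the edge from j to i to a shortest path from [Gamma] to j. *)
Lemma dist_to_le_edge G i j Gamma : Gamma != finset.set0 ->
  dist_to G i Gamma <= dist_to G j Gamma + ((weight G j i)%:E)^-1.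
Proof.
move=> /(dist_to_attained G j)[k kG ->].
have [s <- <-] := graph_dist_attained G k j.
apply: le_trans (dist_to_le _ _ kG) _.
by have := graph_dist_le G k (rcons s i);
  rewrite last_rcons -cats1 path_length_cat/= adde0.
Qed.

(** Remove the last edge of a shortest path from [Gamma] to i; the path has an edge because i lies
    outside [Gamma]. *)
Lemma dist_to_pred G i Gamma : Gamma != finset.set0 -> i \notin Gamma ->
  exists j, dist_to G j Gamma + ((weight G j i)%:E)^-1 <= dist_to G i Gamma.
Proof.
move=> /(dist_to_attained G i)[k kG ->] iG.
have [s] := graph_dist_attained G k i.
case/lastP: s => [/= ki|s l]; first by rewrite -ki kG in iG.
rewrite last_rcons -cats1 path_length_cat/= adde0 => -> <-.
exists (last k s); apply: leeD2r.
exact: le_trans (dist_to_le _ _ kG) (graph_dist_le _ _ _).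
Qed.

End Distance.

(** * Multiples of the distance as barriers *)

Section Barriers.
Context {R : realType} {d n : nat} (p : R) (p_gt0 : 0 < p).
Context (G : weighted_graph R d n) (Gamma : {set 'I_n}).
Context (Gamma_neq0 : Gamma != finset.set0) (G_conn : connected_graph G).
Implicit Types (i j : 'I_n) (c : R).

Let dist i : R := fine (dist_to (graph_pow G (1 / p)) i Gamma).

Let distE i : (dist i)%:E = dist_to (graph_pow G (1 / p)) i Gamma.
Proof. by rewrite fineK// dist_to_fin_num//; exact: connected_graph_pow. Qed.

Lemma le_eikonal_op_dist c i : 0 <= c -> i \notin Gamma ->
  c `^ p <= eikonal_op p G (fun j => c * dist j) i.
Proof.
move=> c0 iG; have [j] := dist_to_pred (graph_pow G (1 / p)) Gamma_neq0 iG.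
rewrite -!distE inver mxE.
(* A zero weight would make the last edge infinitely long, whereas [dist i] is finite. *)
case: eqP => [|/eqP w0]; first by rewrite addey// leNgt ltry.
have {w0} wji : 0 < weight G j i.
  rewrite lt0r weight_ge0 andbT; apply: contra w0 => /eqP ->.
  by rewrite powR0// div1r invr_eq0 gt_eqF.
rewrite -EFinD lee_fin => dji.
rewrite /eikonal_op (bigD1 j)//= -(mulr_pospow_inv p_gt0 wji c0).
(* The term of the predecessor j alone reaches $c^p$; the others are nonnegative. *)
apply: (@le_trans _ _ (weight G j i *
    (Num.max (c * dist i - c * dist j) 0) `^ p)); last first.
  by rewrite lerDl sumr_ge0// => k _; rewrite mulr_ge0 ?weight_ge0 ?powR_ge0.
rewrite ler_wpM2l ?weight_ge0// ler_pospow//.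
by rewrite -mulrBr ler_wpM2l// lerBrDl.
Qed.

Lemma eikonal_op_dist_le c i : 0 <= c ->
  eikonal_op p G (fun j => c * dist j) i <= (max_in_degree G)%:R * c `^ p.
Proof.
move=> c0; apply: (@le_trans _ _
    ((\sum_(j < n) (0 < weight G j i)%R)%:R * c `^ p)); last first.
  by rewrite ler_wpM2r ?powR_ge0// ler_nat; apply: leq_bigmax_cond.
rewrite natr_sum mulr_suml; apply: ler_sum => j _.
have := weight_ge0 G j i; rewrite le_eqVlt => /orP[/eqP <-|wji].
  by rewrite ltxx !mul0r.
rewrite wji mul1r -(mulr_pospow_inv p_gt0 wji c0).
rewrite ler_wpM2l ?weight_ge0// ler_pospow// -mulrBr ler_wpM2l// lerBlDl.
have := dist_to_le_edge (graph_pow G (1 / p)) i j Gamma_neq0.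
by rewrite -!distE inver mxE gt_eqF ?powR_gt0// -EFinD lee_fin.
Qed.

End Barriers.

Theorem theorem2p12 (R : realType) (d n : nat) (G : weighted_graph R d n)
    (Gamma : {set 'I_n}) (p : R) (f : 'I_n -> R)
    (Gamma_neq0 : Gamma != finset.set0)
    (p_gt0 : 0 < p)
    (f_gt0 : forall i, 0 < f i)
    (G_conn : connected_graph G) :
  (exists! u : 'I_n -> R, eikonal_solution p G Gamma f u) /\
  (forall u : 'I_n -> R, eikonal_solution p G Gamma f u ->
   forall i : 'I_n,
     (((max_in_degree G)%:R `^ (- (1 / p)))%:E
        * (\big[Order.min/+oo]_(j < n) (f j `^ (1 / p))%:E)
        * dist_to (graph_pow G (1 / p)) i Gamma <= (u i)%:E
      <= (\big[Order.max/-oo]_(j < n) (f j `^ (1 / p))%:E)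
        * dist_to (graph_pow G (1 / p)) i Gamma)%E).
Proof.
have [k0 _] : exists k, k \in Gamma by exact/finset.set0Pn.
(* Since [k0] is a vertex, both extrema are attained, at [km] and [kM], and are therefore finite. *)
have [km _ minE] := @eq_bigmin _ (\bar R) 'I_n +oo%E k0 predT
  (fun j => (f j `^ (1 / p))%:E) erefl (fun _ _ => leey _).
have [kM _ maxE] := @eq_bigmax _ (\bar R) 'I_n -oo%E k0 predT
  (fun j => (f j `^ (1 / p))%:E) erefl (fun _ _ => leNye _).
have powf x : (f x `^ (1 / p)) `^ p = f x by rewrite powR_invK// ltW.
have le_powf x y : f x `^ (1 / p) <= f y `^ (1 / p) -> f x <= f y.
  move=> xy; rewrite -(powf x) -(powf y).
  by apply: ge0_ler_powR; rewrite ?nnegrE ?powR_ge0 ?(ltW p_gt0).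
have minf i : f km <= f i by rewrite le_powf// -lee_fin -minE bigmin_le.
have maxf i : f i <= f kM by rewrite le_powf// -lee_fin -maxE le_bigmax.
rewrite minE maxE.
pose H := graph_pow G (1 / p); pose dist i := fine (dist_to H i Gamma).
have distE i : dist_to H i Gamma = (dist i)%:E.
  by rewrite fineK// dist_to_fin_num//; exact: connected_graph_pow.
have dist0 i : i \in Gamma -> dist i = 0 by move=> iG; rewrite /dist dist_to_in.
pose M := f kM `^ (1 / p).
have supM i : i \notin Gamma -> f i <= eikonal_op p G (fun j => M * dist j) i.
  move=> iG; rewrite (le_trans (maxf i))// -(powf kM).
  by rewrite le_eikonal_op_dist ?powR_ge0.
split.
  have [||u su] := eikonal_exists p_gt0 _ supM.
  - by move=> i _.
  - by move=> i /dist0 ->; rewrite mulr0.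
  exists u; split=> // v sv; apply/funext => i; apply/eqP; rewrite eq_le.
  (* Each of two solutions is both a subsolution and a supersolution, so comparison applies in both
     directions. *)
  by apply/andP; split; move: i;
    apply: (@eikonal_comparison _ _ _ p p_gt0 G Gamma f); move=> // i iG; rewrite ?su.1 ?sv.1 ?su.2 ?sv.2.
move=> u su i; rewrite distE -!EFinM !lee_fin.
apply/andP; split; last first.
  move: i; apply: (@eikonal_comparison _ _ _ p p_gt0 G Gamma f) => // i iG.
    by rewrite su.1.
  by rewrite su.2// dist0// mulr0.
(* With K the maximal in-degree, $K c^p = K K^{-1} \min f$, which is what the subsolution bound
   calls for. *)
pose c := (max_in_degree G)%:R `^ (- (1 / p)) * f km `^ (1 / p).
have c0 : 0 <= c by rewrite mulr_ge0 ?powR_ge0.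
rewrite -/c; move: i.
apply: (@eikonal_comparison _ _ _ p p_gt0 G Gamma f _ u) => // i iG.
- apply: le_trans (eikonal_op_dist_le p_gt0 Gamma_neq0 G_conn i c0) _.
  apply: le_trans (minf i).
  rewrite powRM ?powR_ge0// powf mulrA -[leRHS]mul1r ler_wpM2r ?(ltW (f_gt0 _))//.
  rewrite -powRrM mulNr -mulNr div1r mulNr mulVf ?gt_eqF// powR_inv1//.
  (* $K K^{-1}$ is 1, or 0 when K = 0; both are at most 1. *)
  by have [->|K0] := eqVneq (max_in_degree G) 0%N;
    rewrite ?mul0r// divff// pnatr_eq0.
- by rewrite su.1.
- by rewrite su.2// dist0// mulr0.
Qed.
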